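(* Let $n,r,s\geq 1$ be integers, $d=\gcd(r,n,s)$, $R=r/d$, $N=n/d$, $S=s/d$, and let \[f^{r,s}(t)=1+t+t^2+\cdots+t^{r-1}-t^r(1+t+t^2+\cdots+t^{s-1}).\] Let $C$ be the $n\times n$ circulant matrix associated with $f^{r,s}(t)$, let $\rho$ be its rank and let $\gamma_\rho$ be its last non-zero determinantal divisor. (a) If $s>r$ then $\rho=n-d+1$ and \[\gamma_\rho=\frac{\mathrm{Res}(f^{R,S}(t),t^N-1)^d}{(S-R)^{d-1}}.\] (b) If $s=r$ then $\rho=n-d$ and $\gamma_\rho=N^{d-1}$.
   Context: The $n\times n$ circulant matrix associated with $f\in\mathbb{Z}[t]$ is the circulant matrix whose first row is $(a_0,\ldots,a_{n-1})$, where $\sum_{i=0}^{n-1}a_it^i$ is the remainder of $f$ modulo $t^n-1$ (exponents are taken mod $n$). If the Smith normal form of $C$ is $\mathrm{diag}_n(s_1,\ldots,s_\rho,0,\ldots,0)$ with $\rho=\mathrm{rank}(C)$ and all $s_i\neq 0$, the last non-zero determinantal divisor is $\gamma_\rho=\prod_{i=1}^\rho s_i$, taken positive (equal to $1$ if $\rho=0$). $\mathrm{Res}(\cdot,\cdot)$ denotes the absolute value of the resultant. $f^{R,S}$ is given by the same formula as $f^{r,s}$ with $R,S$ in place of $r,s$. *)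

(* Defs.v *)
From mathcomp Require Import all_boot all_order all_algebra.

Set Implicit Arguments.
Unset Strict Implicit.
Unset Printing Implicit Defensive.

Import Order.TTheory GRing.Theory Num.Theory.
Local Open Scope ring_scope.

Definition frs (r s : nat) : {poly int} :=
  \sum_(i < r) 'X^i - 'X^r * \sum_(i < s) 'X^i.

(* The first row is a_0, ..., a_(n-1), and row i is the first row shifted
   cyclically i places to the right.  'X^n - 1 is monic for 0 < n, so %% is
   genuine Euclidean division in {poly int}, with no pseudo-division factor. *)
Definition circulant (n : nat) (f : {poly int}) : 'M[int]_n :=
  \matrix_(i < n, j < n) (f %% ('X^n - 1))`_((n + j - i) %% n)%N.

Definition int_rank (n : nat) (M : 'M[int]_n) : nat :=
  \rank (map_mx (intr : int -> rat) M).

(* Since every integer divides 0 and 0 divides only 0, the divisibility chain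
   puts the zero entries last.  The entries are not normalised in sign. *)
Definition smith_form (n : nat) (M : 'M[int]_n) (e : 'rV[int]_n) : Prop :=
  (forall i j : 'I_n, (i <= j)%N -> (e ord0 i %| e ord0 j)%Z) /\
  exists P Q : 'M[int]_n,
    [/\ P \in unitmx, Q \in unitmx & M = P *m diag_mx e *m Q].

Lemma smith_form_exists (n : nat) (M : 'M[int]_n) :
  exists e : 'rV[int]_n, smith_form M e.
Proof.
have [P Pu [Q Qu [d d_sorted defM]]] := int_Smith_normal_form M.
exists (\row_i d`_i); split=> [i j le_ij|].
  rewrite !mxE; have [ltj | gej] := ltnP j (size d); last first.
    by rewrite (nth_default _ gej) dvdz0.
  apply: (sorted_leq_nth (leT := dvdz)) => //.
  - by move=> y x z; apply: dvdz_trans.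
  - by move=> x; apply: dvdzz.
  - by rewrite inE; apply: leq_ltn_trans ltj.
exists P, Q; split=> //; rewrite {1}defM; congr (_ *m _ *m _).
by apply/matrixP=> i j; rewrite !mxE.
Qed.

(* The k-th determinantal divisor of a matrix with Smith form e; the absolute
   value makes it positive when nonzero, and it is 1 for k = 0. *)
Definition det_divisor (n : nat) (e : 'rV[int]_n) (k : nat) : nat :=
  absz (\prod_(i < n | (i < k)%N) e 0 i).

Definition Res (p q : {poly int}) : nat := absz (resultant p q).

(* Main.v *)
(* With [d = gcd(r, n, s)], [Phi = (X^d - 1) / (X - 1)], [g = f^{R,S}] and
   [Psi = (X^N - 1) / (X - 1)], one has [f^{r,s} = Phi * g(X^d)].  When
   [X^n - 1 = D * h] and [f = D * k] with [k] prime to [h], multiplication by [f]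
   modulo [X^n - 1] is reduction modulo [h], followed by multiplication by [k]
   modulo [h], followed by multiplication by [D]; the outer two maps are split
   over the integers, so the rank is [deg h] and the last nonzero determinantal
   divisor is the absolute value of the product of [k] over the roots of [h].
   For [s > r] take [D = Phi], [k = g(X^d)] and [h = (X - 1) * Psi(X^d)]; for
   [s = r] take [D = X^d - 1], [h = Psi(X^d)] and
   [k = - Phi * ((X^R - 1) / (X - 1))(X^d) ^ 2].  The roots of [Psi(X^d)] are the
   [n]-th roots of unity [x] with [x^d <> 1], and [x^d] takes each nontrivial
   [N]-th root of unity as a value exactly [d] times. *)
Require Import Defs.
From mathcomp Require Import all_boot all_order all_algebra all_field.
From mathcomp Require Import ring.

Import Order.TTheory GRing.Theory Num.Theory.
Local Open Scope ring_scope.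
Import Pdiv.IdomainUnit.

Local Notation toC := (map_poly (intr : int -> algC)).

(** * Integer matrices factored through a core by split outer factors *)

Lemma split_core {n rho : nat} {M : 'M[int]_n} {B : 'M[int]_rho}
    {U U' V V'} : U' *m U = 1%:M -> V *m V' = 1%:M -> M = U *m B *m V ->
  B = U' *m M *m V'.
Proof.
by move=> U'U VV' ->; rewrite !mulmxA U'U mul1mx -mulmxA VV' mulmx1.
Qed.

(** [B] has full rank [rho] over the rationals, and each of [M] and [B] is a product with the other
    as a factor, so their ranks agree. *)
Lemma int_rank_split {n rho : nat} {M : 'M[int]_n} {B : 'M[int]_rho}
    {U U' V V'} : U' *m U = 1%:M -> V *m V' = 1%:M -> M = U *m B *m V ->
  \det B != 0 -> int_rank M = rho.
Proof.
move=> U'U VV' defM detB; have defB := split_core U'U VV' defM.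
apply/eqP; rewrite eqn_leq /int_rank {1}defM !map_mxM.
set UBV := _ *m _; have -> /= : (\rank UBV <= rho)%N.
  by apply: mulmx_max_rank.
have rkB : \rank (map_mx (intr : int -> rat) B) = rho.
  by rewrite mxrank_unit // unitmxE det_map_mx unitfE intr_eq0.
rewrite -{1}rkB defB !map_mxM.
by apply: leq_trans (mxrankM_maxl _ _) (mxrankM_maxr _ _).
Qed.

Lemma sum_delta_widen {R : pzRingType} {k n : nat} (le_kn : (k <= n)%N)
    (i : 'I_k) (F : 'I_n -> R) :
  \sum_(l < n) (i == l :> nat)%:R * F l = F (widen_ord le_kn i).
Proof.
rewrite (bigD1 (widen_ord le_kn i)) //= eqxx mul1r big1 ?addr0 // => l ne_l.
have /negPf-> : (i : nat) != l.
  by apply: contraNneq ne_l => il; apply/eqP/val_inj.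
by rewrite mul0r.
Qed.

(* [B] and the nonzero diagonal block of the Smith form factor through each
   other over the integers, so their determinants divide one another. *)
Lemma det_divisor_split {n rho : nat} {M : 'M[int]_n} {B : 'M[int]_rho}
    {U U' V V'} {e : 'rV[int]_n} :
  U' *m U = 1%:M -> V *m V' = 1%:M -> M = U *m B *m V -> \det B != 0 ->
  (rho <= n)%N -> smith_form M e -> det_divisor e rho = absz (\det B).
Proof.
move=> U'U VV' defM detB le_rho_n [e_chain [P [Q [Pu Qu defM']]]].
have defB := split_core U'U VV' defM.
have rkM := int_rank_split U'U VV' defM detB.
have diag_e : diag_mx e = invmx P *m M *m invmx Q.
  by rewrite defM' !mulmxA mulVmx // mul1mx -mulmxA mulmxV // mulmx1.
(* [emb k] is the block matrix [I, 0]; sandwiching by it and its transpose cuts out the leading [k]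
   by [k] block. *)
pose emb k : 'M[int]_(k, n) := \matrix_(i, j) (i == j :> nat)%:R.
have embD k (le_kn : (k <= n)%N) :
    emb k *m diag_mx e *m (emb k)^T = diag_mx (\row_i e 0 (widen_ord le_kn i)).
  apply/matrixP=> i j; rewrite -mulmxA mul_diag_mx !mxE.
  under eq_bigr => l _ do rewrite !mxE.
  rewrite (sum_delta_widen le_kn) /= mulr_natr; congr (_ *+ _).
  by rewrite eq_sym val_eqE.
(* By the divisibility chain, a nonzero [e 0 j] would make the first [j.+1] entries nonzero, giving
   a diagonal block of rank [j.+1 > rho]. *)
have e0 (j : 'I_n) : (rho <= j)%N -> e 0 j = 0.
  move=> le_rj; apply/eqP/negPn/negP => ej0.
  have le_jn := ltn_ord j.
  have := embD _ le_jn; set D := diag_mx (\row_i _) => defD.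
  have : (\rank (map_mx (intr : int -> rat) D) <= rho)%N.
    rewrite -rkM -defD /int_rank.
    rewrite diag_e !map_mxM; apply: leq_trans (mxrankM_maxl _ _) _.
    apply: leq_trans (mxrankM_maxr _ _) _.
    by apply: leq_trans (mxrankM_maxl _ _) (mxrankM_maxr _ _).
  rewrite mxrank_unit; first by rewrite leqNgt ltnS le_rj.
  rewrite unitmxE det_map_mx unitfE intr_eq0.
  rewrite det_diag; apply/prodf_neq0 => i _; rewrite mxE.
  apply: contraNneq ej0 => ei0; rewrite -dvd0z -ei0; apply: e_chain.
  by rewrite /= -ltnS.
pose D := diag_mx (\row_i e 0 (widen_ord le_rho_n i)).
have diag_emb : diag_mx e = (emb rho)^T *m D *m emb rho.
  apply/matrixP=> i j; rewrite -mulmxA mul_diag_mx !mxE.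
  have [lt_jr | le_rj] := ltnP j rho; last first.
    rewrite big1 => [|l _]; first by have [->|//] := eqVneq i j; rewrite e0.
    by rewrite !mxE (ltn_eqF (leq_trans (ltn_ord l) le_rj)) !mulr0.
  rewrite (bigD1 (Ordinal lt_jr)) //= big1 => [|l ne_l]; last first.
    by rewrite !mxE (negPf ne_l : (l == j :> nat) = false) !mulr0.
  rewrite !mxE eqxx addr0 mulr1 (_ : widen_ord _ _ = j); last exact: val_inj.
 rewrite /= [_ == _ :> nat]eq_sym val_eqE.
  by case: eqP => [->|_]; rewrite ?mul1r ?mul0r.
have absD : det_divisor e rho = absz (\det D).
  rewrite /det_divisor det_diag (big_ord_narrow le_rho_n).
  by congr absz; apply: eq_bigr => i _; rewrite mxE.
rewrite absD; apply/eqP; rewrite eqn_dvd; apply/andP; split; rewrite -dvdzE.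
  have -> : \det B =
      \det (U' *m P *m (emb rho)^T) * \det D * \det (emb rho *m Q *m V').
    by rewrite -!det_mulmx defB defM' diag_emb !mulmxA.
  by rewrite mulrAC dvdz_mull.
have -> : \det D = \det (emb rho *m invmx P *m U) * \det B *
                  \det (V *m invmx Q *m (emb rho)^T).
  rewrite -!det_mulmx /D -embD; congr (\det _).
  by rewrite diag_e defM !mulmxA.
by rewrite mulrAC dvdz_mull.
Qed.

(** * Circulants as multiplication modulo X^n - 1 *)

(** Images are stored as rows, so a matrix product applies its left factor first. Coefficients from
    index [n] on are dropped, whence the size condition in [polymxM]. *)
Definition polymx {R : nzRingType} (m n : nat) (phi : {poly R} -> {poly R}) :
    'M[R]_(m, n) :=
  \matrix_(i, j) (phi 'X^i)`_j.

Lemma polymxM {R : comNzRingType} {m n p : nat}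
    {phi psi : {poly R} -> {poly R}} :
  linear psi -> (forall i, (i < m)%N -> (size (phi 'X^i) <= n)%N) ->
  polymx m n phi *m polymx n p psi = polymx m p (psi \o phi).
Proof.
move=> psi_lin le_phi_n; apply/matrixP=> i l; rewrite !mxE /=.
have psiD x y : psi (x + y) = psi x + psi y.
  by have := psi_lin 1 x y; rewrite !scale1r.
have psi0 : psi 0 = 0 by apply: (addrI (psi 0)); rewrite -psiD !addr0.
have psiZ a x : psi (a *: x) = a *: psi x.
  by have := psi_lin a x 0; rewrite psi0 !addr0.
have -> : phi 'X^i = \sum_(j < n) (phi 'X^i)`_j *: 'X^j.
  rewrite -poly_def; apply/polyP=> j; rewrite coef_poly.
  by case: ltnP => // le_nj; rewrite nth_default // (leq_trans (le_phi_n _ _)).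
rewrite (big_morph psi psiD psi0) coef_sum.
by apply: eq_bigr => j _; rewrite !mxE psiZ coefZ.
Qed.

Lemma eq_polymx {R : nzRingType} {m n : nat} {phi psi : {poly R} -> {poly R}} :
  (forall i, (i < m)%N -> phi 'X^i = psi 'X^i) ->
  polymx m n phi = polymx m n psi.
Proof. by move=> eq_phi; apply/matrixP=> i j; rewrite !mxE eq_phi. Qed.

Lemma polymx_id {R : nzRingType} (m : nat) : @polymx R m m id = 1%:M.
Proof. by apply/matrixP=> i j; rewrite !mxE coefXn eq_sym. Qed.

Lemma monic_lead_unit {R : idomainType} {q : {poly R}} :
  q \is monic -> lead_coef q \is a GRing.unit.
Proof. by move=> /monicP->; apply: unitr1. Qed.

Lemma modp_linear {R : idomainType} {q : {poly R}} :
  q \is monic -> linear (fun p => p %% q).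
Proof. by move=> /monic_lead_unit qu a x y; rewrite modpD // modpZl. Qed.

Lemma divp_linear {R : idomainType} {q : {poly R}} :
  q \is monic -> linear (fun p => p %/ q).
Proof. by move=> /monic_lead_unit qu a x y; rewrite divpD // divpZl. Qed.

Lemma modXn_Xnsub1 {R : idomainType} (n m : nat) :
  (0 < n)%N -> 'X^m %% ('X^n - 1) = 'X^(m %% n) :> {poly R}.
Proof.
move=> n_gt0; have mon : 'X^n - 1 \is @monic R by rewrite monicXnsubC.
rewrite [in LHS](divn_eq m n); apply/esym.
(* With q = m / n, the difference X^(q n) - 1 is X^n - 1 times a geometric sum in X^n, which gives
   the quotient. *)
apply: (modpP (monic_lead_unit mon)
  (q := 'X^(m %% n) * \sum_(i < (m %/ n)%N) ('X^n) ^+ i)).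
  rewrite -mulrA [_ * ('X^n - 1)]mulrC -subrX1 mulrBr mulr1 subrK.
  by rewrite exprD mulrC mulnC exprM.
by rewrite size_polyXn size_XnsubC // ltnS ltn_mod.
Qed.

(** Modulo X^n - 1, multiplication by X shifts the coefficients cyclically by one place. *)
Lemma circulant_polymx (n : nat) (f : {poly int}) : (0 < n)%N ->
  circulant n f = polymx n n (fun p => (p * f) %% ('X^n - 1)).
Proof.
move=> n_gt0; apply/matrixP=> i j; rewrite !mxE.
have mon : 'X^n - 1 \is @monic int by rewrite monicXnsubC.
pose a := f %% ('X^n - 1); rewrite -/a.
have le_an : (size a <= n)%N.
  by rewrite -ltnS -(@size_XnsubC _ n (1 : int)) // ltn_modpN0 // monic_neq0.
have -> : ('X^i * f) %% ('X^n - 1) = ('X^i * a) %% ('X^n - 1).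
  rewrite {1}(divp_eq (monic_lead_unit mon) f) mulrDr modpD ?monic_lead_unit //.
  by rewrite mulrA modp_mull add0r.
have -> : 'X^i * a = \sum_(k < n) a`_k *: 'X^(i + k).
  rewrite [in LHS](_ : a = \poly_(k < n) a`_k).
    rewrite poly_def mulr_sumr; apply: eq_bigr => k _.
    by rewrite -scalerAr exprD.
  apply/polyP=> k; rewrite coef_poly.
  by case: ltnP => // le_nk; rewrite nth_default // (leq_trans le_an).
have qu := monic_lead_unit mon.
rewrite (big_morph (fun p => p %% ('X^n - 1)) (modpD qu) (mod0p _)).
(* Only the term whose index k satisfies i + k = j modulo n reaches coefficient j; this is that
   index. *)
have lt_kn : ((n + j - i) %% n < n)%N by rewrite ltn_mod.
have k0E : ((i + (n + j - i) %% n) %% n = j)%N.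
  rewrite modnDmr subnKC ?modnDl ?modn_small //.
  by rewrite (leq_trans (ltnW (ltn_ord i))) // leq_addr.
rewrite coef_sum (bigD1 (Ordinal lt_kn)) //= modpZl // modXn_Xnsub1 //.
rewrite coefZ coefXn k0E eqxx mulr1 big1 ?addr0 // => k ne_k.
rewrite modpZl // modXn_Xnsub1 // coefZ coefXn; case: eqP => [jE|]; last first.
  by rewrite mulr0.
case/eqP: ne_k; apply: val_inj => /=; apply/eqP.
rewrite -[X in X == _](modn_small (ltn_ord k)) -(modn_mod (n + j - i)).
rewrite -(eqn_modDl i).
by rewrite k0E -jE.
Qed.

(** [U] reduces modulo [h] and is split by the inclusion of polynomials of degree below [rho]; [V]
    multiplies by [D] and is undone by the quotient by [D]. *)
Lemma mulmod_split {n rho : nat} {D h : {poly int}} (k : {poly int}) :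
    (0 < n)%N -> D \is monic -> h \is monic -> D * h = 'X^n - 1 -> size h = rho.+1 ->
  exists U V U' V',
    [/\ U' *m U = 1%:M, V *m V' = 1%:M &
        circulant n (D * k) =
        U *m polymx rho rho (fun p => (p * k) %% h) *m V].
Proof.
move=> n_gt0 monD monh Dh size_h.
have nzh := monic_neq0 monh; have nzD := monic_neq0 monD.
have size_mod p : (size (p %% h)%R <= rho)%N.
  by rewrite -ltnS -size_h ltn_modpN0.
have size_D (p : {poly int}) : (size p <= rho)%N -> (size (D * p)%R <= n)%N.
  move=> le_p; have [->|nzp] := eqVneq p 0; first by rewrite mulr0 size_poly0.
  rewrite -ltnS -(@size_XnsubC _ n (1 : int)) // -Dh !size_monicM // size_h.
  by rewrite addnS /= prednK ?addn_gt0 ?size_poly_gt0 ?nzp ?orbT // leq_add2l.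
have le_rho_n : (rho <= n)%N.
  rewrite -ltnS -(@size_XnsubC _ n (1 : int)) // -Dh size_monicM // size_h.
  by rewrite addnS /= -[X in (X < _)%N]add0n ltn_add2r size_poly_gt0.
have D_lin : linear (fun p => D * p).
  by move=> a x y; rewrite mulrDr scalerAr.
exists (polymx n rho (fun p => p %% h)), (polymx rho n (fun p => D * p)).
exists (polymx rho n id), (polymx n rho (fun p => p %/ D)); split.
- rewrite polymxM; last 2 first.
  + exact: modp_linear.
  + by move=> i lt_i; rewrite size_polyXn (leq_trans lt_i).
  rewrite -polymx_id; apply: eq_polymx => i lt_i /=.
  by rewrite modp_small // size_polyXn size_h.
- rewrite polymxM; last 2 first.
  + exact: divp_linear.
  + by move=> i lt_i; rewrite size_D // size_polyXn.
  rewrite -polymx_id; apply: eq_polymx => i lt_i /=.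
  by rewrite Pdiv.IdomainMonic.mulKp.
rewrite circulant_polymx // -mulmxA polymxM //.
rewrite polymxM; last 2 first.
- move=> a x y /=; rewrite mulrDl -scalerAl modp_linear //.
  by rewrite mulrDr scalerAr.
- by move=> i _; apply: size_mod.
apply: eq_polymx => i _ /=; set p := 'X^i; apply/esym.
have hu := monic_lead_unit monh.
have monDh : 'X^n - 1 \is @monic int by rewrite monicXnsubC.
(* If p = a h + b and b k = a' h + b', then p D k = (a k + a') D h + D b', and D b' has degree below
   n. *)
apply: (modpP (monic_lead_unit monDh) (q := p %/ h * k + (p %% h * k) %/ h)).
  rewrite -Dh {1}(divp_eq hu p) mulrDl mulrDl.
  have -> : p %% h * (D * k) = D * (p %% h * k) by rewrite mulrCA.
  rewrite {1}(divp_eq hu (p %% h * k)) mulrDr addrA; congr (_ + _).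
  by rewrite mulrACA mulrC [h * k]mulrC; ring.
by rewrite size_XnsubC // ltnS size_D.
Qed.

(** * Determinants and resultants as products over roots *)

Lemma det_Vandermonde_uniq {F : fieldType} {n : nat} {rs : seq F} :
  uniq rs -> size rs = n -> \det (Vandermonde n (\row_(j < n) rs`_j)) != 0.
Proof.
move=> rs_uniq size_rs; rewrite det_Vandermonde.
apply/prodf_neq0 => i _; apply/prodf_neq0 => j lt_ij.
by rewrite !mxE subr_eq0 nth_uniq ?size_rs // gtn_eqF.
Qed.

Lemma coef_horner_wide {p : {poly int}} {n : nat} (x : algC) :
  (size p <= n)%N -> \sum_(j < n) (p`_j)%:~R * x ^+ j = (toC p).[x].
Proof.
move=> le_pn; rewrite (horner_coef_wide _ (leq_trans (size_poly _ _) le_pn)).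
by apply: eq_bigr => j _; rewrite coef_map.
Qed.

(* The Vandermonde matrix of the roots of [h] diagonalises multiplication
   modulo [h]. *)
Lemma det_mulmod_roots {h : {poly int}} {rs : seq algC} (k : {poly int}) :
  h \is monic -> uniq rs -> all (root (toC h)) rs ->
  size h = (size rs).+1 ->
  (\det (polymx (size rs) (size rs) (fun p => (p * k) %% h)))%:~R =
    \prod_(a <- rs) (toC k).[a].
Proof.
move=> monh rs_uniq rs_root size_h; set B := polymx _ _ _.
have detV := det_Vandermonde_uniq rs_uniq erefl.
set V := Vandermonde _ _ in detV.
apply: (mulIf detV); rewrite -det_map_mx -det_mulmx.
pose D : 'M[algC]_(size rs) := diag_mx (\row_j (toC k).[rs`_j]).
suff -> : map_mx intr B *m V = V *m D.
  rewrite det_mulmx mulrC det_diag (big_nth 0) big_mkord; congr (_ * _).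
  by apply: eq_bigr => j _; rewrite mxE.
apply/matrixP=> i j; rewrite mul_mx_diag !mxE.
under eq_bigr => l _ do rewrite !mxE.
rewrite coef_horner_wide; last first.
  by rewrite -ltnS -size_h ltn_modpN0 // monic_neq0.
have rj : (toC h).[rs`_j] = 0 by apply/eqP/(allP rs_root)/mem_nth.
have := divp_eq (monic_lead_unit monh) ('X^i * k).
move=> /(congr1 (fun p => (toC p).[rs`_j])).
by rewrite /= rmorphD !rmorphM /= !hornerE rj mulr0 add0r map_polyXn hornerXn.
Qed.

(* Right multiplication by [[V, 0], [*, 1]], with [V] the Vandermonde matrix of
   the roots of [q], makes the Sylvester matrix block upper triangular. *)
Lemma resultant_roots {p q : {poly int}} {rs : seq algC} :
  q \is monic -> uniq rs -> all (root (toC q)) rs -> size q = (size rs).+1 ->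
  (resultant p q)%:~R = \prod_(a <- rs) (toC p).[a].
Proof.
move=> monq rs_uniq rs_root size_q.
have size_rs : size rs = (size q).-1 by rewrite size_q.
rewrite /resultant; set S := Sylvester_mx p q.
set dq := (size q).-1 in S size_rs *; set dp := (size p).-1 in S *.
have detV := det_Vandermonde_uniq rs_uniq size_rs.
set V := Vandermonde _ _ in detV.
(* The first [dq] columns hold powers of the roots, so multiplying by them evaluates the row
   polynomials of [S] at the roots; the other columns are unit vectors and copy columns of [S]. *)
pose W : 'M[algC]_(dq + dp) := \matrix_(i, j)
  match split j with inl l => rs`_l ^+ i | inr c => (i == rshift dq c)%:R end.
have WE : W = block_mx V 0 (dlsubmx W) 1%:M.
  rewrite -[LHS]submxK; congr block_mx; apply/matrixP=> i j; rewrite !mxE.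
  - by rewrite (unsplitK (inl j)).
  - by rewrite (unsplitK (inr j)) eq_lrshift.
  - by rewrite (unsplitK (inr j)) eq_rshift.
have detW : \det W = \det V by rewrite WE det_lblock det1 mulr1.
have SE_u (i : 'I_dq) j : S (lshift dp i) j = (p * 'X^i)`_j.
  rewrite Sylvester_mxE (unsplitK (inl i)) coefMXn ltnNge.
  by case: leqP.
have SE_d (i : 'I_dp) j : S (rshift dq i) j = (q * 'X^i)`_j.
  rewrite Sylvester_mxE (unsplitK (inr i)) coefMXn ltnNge.
  by case: leqP.
clearbody S; pose Y := map_mx intr S *m W.
have size_sh (f : {poly int}) i m :
    (i < m)%N -> (size (f * 'X^i)%R <= m + (size f).-1)%N.
  move=> lt_im; have [->|nzf] := eqVneq f 0; first by rewrite mul0r size_poly0.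
  rewrite size_Mmonic ?monicXn // size_polyXn addnS /=.
  by rewrite -(prednK (_ : 0 < size f)%N) ?size_poly_gt0 //
       addSnnS addnC leq_add2r.
have Yul : ulsubmx Y = V *m diag_mx (\row_j (toC p).[rs`_j]).
  apply/matrixP=> i j; rewrite mul_mx_diag !mxE.
  under eq_bigr => l _ do rewrite !mxE (unsplitK (inl j)) SE_u.
  rewrite coef_horner_wide ?size_sh //.
  by rewrite rmorphM /= map_polyXn hornerM hornerXn mulrC.
have Ydl : dlsubmx Y = 0.
  apply/matrixP=> i j; rewrite !mxE.
  under eq_bigr => l _ do rewrite !mxE (unsplitK (inl j)) SE_d.
  rewrite coef_horner_wide; last by rewrite addnC size_sh.
  rewrite rmorphM /= hornerM.
  have /eqP-> : root (toC q) rs`_j.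
    by apply/(allP rs_root)/mem_nth; rewrite size_rs.
  by rewrite mul0r.
have YdrE i j : drsubmx Y i j = ((q * 'X^i)`_(dq + j))%:~R.
  rewrite !mxE (bigD1 (rshift dq j)) //= !mxE (unsplitK (inr j)) eqxx mulr1.
  rewrite SE_d big1 ?addr0 // => l /negPf ne_l.
  by rewrite !mxE (unsplitK (inr j)) ne_l mulr0.
(* Entry (i, j) is the coefficient of [q] at dq + j - i: zero above the diagonal, and the leading
   coefficient 1 on it. *)
have detYdr : \det (drsubmx Y) = 1.
  rewrite det_trig => [|].
    rewrite big1 // => i _; rewrite YdrE coefMXn ltnNge leq_addl addnK.
    by rewrite -[_`_dq]/(lead_coef q) (monicP monq).
  apply/is_trig_mxP=> i j lt_ij; rewrite YdrE coefMXn ltnNge.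
  rewrite (leq_trans (ltnW lt_ij) (leq_addl _ _)) /= nth_default //.
  by rewrite size_q -size_rs -addnBA ?(ltnW lt_ij) // -addn1 leq_add2l subn_gt0.
apply: (mulIf detV); rewrite -{1}detW -det_map_mx -det_mulmx -/Y -(submxK Y).
rewrite Yul Ydl det_ublock detYdr mulr1 det_mulmx mulrC det_diag; congr (_ * _).
rewrite (big_nth 0) big_mkord size_rs.
by apply: eq_bigr => j _; rewrite mxE.
Qed.

(** That [k] is prime to [h] enters as the nonvanishing of the product of [k] over the roots of [h],
    which is the determinant of the core. *)
Lemma circulant_invariants {n : nat} {D h k : {poly int}} {rs : seq algC}
    {e : 'rV[int]_n} : (0 < n)%N ->
    D \is monic -> h \is monic -> D * h = 'X^n - 1 ->
    uniq rs -> all (root (toC h)) rs -> size h = (size rs).+1 ->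
    \prod_(a <- rs) (toC k).[a] != 0 -> smith_form (circulant n (D * k)) e ->
  int_rank (circulant n (D * k)) = size rs /\
  (det_divisor e (size rs))%:R = `|\prod_(a <- rs) (toC k).[a]|.
Proof.
move=> n_gt0 monD monh Dh rs_uniq rs_root size_h.
rewrite -(det_mulmod_roots k monh rs_uniq rs_root size_h) intr_eq0.
move=> detB smithC.
have [U [V [U' [V' [U'U VV' defC]]]]] :=
  mulmod_split k n_gt0 monD monh Dh size_h.
split; first exact: int_rank_split U'U VV' defC detB.
rewrite (det_divisor_split U'U VV' defC detB _ smithC).
  by rewrite natr_absz intr_norm.
rewrite -ltnS -size_h -(@size_XnsubC _ n (1 : int)) // -Dh.
rewrite size_monicM ?monic_neq0 // -(prednK (_ : (0 < size D)%N)) //.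
  by rewrite leq_addl.
by rewrite size_poly_gt0 monic_neq0.
Qed.

(** * Geometric sums and factorisations of f^{r,s} *)

Definition geo (n : nat) : {poly int} := \sum_(i < n) 'X^i.

Lemma geoM (m d : nat) : ('X^d - 1) * (geo m \Po 'X^d) = 'X^(m * d) - 1.
Proof.
rewrite mulnC exprM [RHS]subrX1 /geo rmorph_sum; congr (_ * _).
by apply: eq_bigr => i _; rewrite rmorphXn /= comp_polyX.
Qed.

Lemma geoX1 (m : nat) : ('X - 1) * geo m = 'X^m - 1.
Proof. by rewrite subrX1. Qed.

Lemma geo_comp_monic {m d : nat} :
  (0 < m)%N -> (0 < d)%N -> geo m \Po 'X^d \is monic.
Proof.
move=> m_gt0 d_gt0; rewrite -(monicMl _ (monicXnsubC 1 d_gt0)) geoM.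
by rewrite monicXnsubC // muln_gt0 m_gt0.
Qed.

Lemma geo_monic {m : nat} : (0 < m)%N -> geo m \is monic.
Proof. by move=> /geo_comp_monic/(_ (ltnSn 0)); rewrite expr1 comp_polyXr. Qed.

Lemma size_geo_comp {m d : nat} : (0 < m)%N -> (0 < d)%N ->
  size (geo m \Po 'X^d) = (d * m.-1).+1.
Proof.
move=> m_gt0 d_gt0; have := congr1 (fun p : {poly int} => size p) (geoM m d).
rewrite size_monicM ?monicXnsubC ?monic_neq0 ?geo_comp_monic //.
rewrite !size_XnsubC ?muln_gt0 ?m_gt0 //= => size_h.
apply: (@addnI d); rewrite size_h -{1}(prednK m_gt0) addnS mulSn.
by rewrite [(d * _)%N]mulnC.
Qed.

Lemma frs_geo (r s : nat) : frs r s = geo r - 'X^r * geo s.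
Proof. by []. Qed.

Lemma Xsub1_neq0 : 'X - 1 != 0 :> {poly int}.
Proof. exact/monic_neq0/monicXsubC. Qed.

(** Clearing the denominator X - 1 of the geometric sums leaves only monomials; the factorisations
    and the location of the zeros both start from this form. *)
Lemma Xsub1_frs (r s : nat) :
  ('X - 1) * frs r s = 'X^r - 1 - 'X^r * ('X^s - 1).
Proof. by rewrite frs_geo mulrBr mulrCA !geoX1. Qed.

Lemma frs_comp (R S d : nat) :
  geo d * (frs R S \Po 'X^d) = frs (R * d) (S * d).
Proof.
apply: (mulfI Xsub1_neq0); rewrite Xsub1_frs mulrA geoX1 frs_geo.
rewrite rmorphB rmorphM /= rmorphXn /= comp_polyX -exprM mulrBr mulrCA !geoM.
by rewrite [(d * R)%N]mulnC.
Qed.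

(** With y = X^(R d), the numerator is (y - 1) - y (y - 1) = - (y - 1)^2, and y - 1 is X^d - 1 times
    [geo R] at X^d. One factor X^d - 1 is kept, the other is (X - 1) [geo d]. *)
Lemma frs_diag_comp (R d : nat) :
  ('X^d - 1) * - (geo d * (geo R \Po 'X^d) ^+ 2) = frs (R * d) (R * d).
Proof.
apply: (mulfI Xsub1_neq0); rewrite Xsub1_frs -geoM.
have -> : 'X^(R * d) = ('X^d - 1) * (geo R \Po 'X^d) + 1 :> {poly int}.
  by rewrite geoM subrK.
by rewrite -geoX1; ring.
Qed.

Lemma toC_comp (p : {poly int}) (d : nat) (x : algC) :
  (toC (p \Po 'X^d)).[x] = (toC p).[x ^+ d].
Proof. by rewrite map_comp_poly map_polyXn horner_comp hornerXn. Qed.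

Lemma toC_geo (m : nat) (x : algC) : (x - 1) * (toC (geo m)).[x] = x ^+ m - 1.
Proof.
have := congr1 (fun p => (toC p).[x]) (geoX1 m).
by rewrite !(rmorphM, rmorphB, rmorph1) /= map_polyX map_polyXn !hornerE.
Qed.

Lemma toC_geo1 (m : nat) : (toC (geo m)).[1] = m%:R.
Proof.
rewrite /geo rmorph_sum /= horner_sum.
under eq_bigr => i _ do rewrite map_polyXn hornerXn expr1n.
by rewrite sumr_const card_ord.
Qed.

Lemma frs1 (r s : nat) : (toC (frs r s)).[1] = r%:R - s%:R.
Proof.
rewrite frs_geo rmorphB rmorphM /= map_polyXn !hornerE !toC_geo1.
by rewrite expr1n mul1r.
Qed.

(** [rs] has as many distinct entries as the degree of [h], so the monic [h] is the product of the X
    - a. *)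
Lemma prod_1sub_roots {h : {poly int}} {rs : seq algC} :
  h \is monic -> uniq rs -> all (root (toC h)) rs -> size h = (size rs).+1 ->
  \prod_(a <- rs) (1 - a) = (toC h).[1].
Proof.
move=> monh rs_uniq rs_root size_h.
have monhC : toC h \is monic by apply: monic_map.
rewrite (@all_roots_prod_XsubC _ (toC h) rs) ?uniq_rootsE //.
  rewrite (monicP monhC) scale1r horner_prod.
  by apply: eq_bigr => a _; rewrite hornerXsubC.
by rewrite size_map_inj_poly //; apply: intr_inj.
Qed.

(** * The roots of unity of order dividing N d whose d-th power is not 1 *)

Section NontrivialPowerRoots.

Variables (N d : nat) (z : algC).
Hypotheses (N_gt0 : (0 < N)%N) (d_gt0 : (0 < d)%N).
Hypothesis z_prim : (N * d).-primitive_root z.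

(** The exponents N a + b are those below N d that N does not divide. The d-th power depends on b
    only, so the double enumeration displays the d-element fibres of x -> x^d. *)
Definition nontriv_roots : seq algC :=
  [seq z ^+ (N * a + b) | a <- iota 0 d, b <- iota 1 N.-1].

Lemma prim_exp_d : N.-primitive_root (z ^+ d).
Proof.
have := exp_prim_root z_prim d.
by rewrite (gcdn_idPl _) ?dvdn_mull // mulnK.
Qed.

Lemma nontriv_roots_exp (a b : nat) : (z ^+ (N * a + b)) ^+ d = (z ^+ d) ^+ b.
Proof.
rewrite -!exprM mulnDl exprD mulnAC exprM (prim_expr_order z_prim) expr1n mul1r.
by rewrite mulnC.
Qed.

Lemma size_nontriv_roots : size nontriv_roots = (d * N.-1)%N.
Proof. by rewrite size_allpairs !size_iota. Qed.

Lemma prod_nontriv_roots (F : algC -> algC) :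
  \prod_(x <- nontriv_roots) F (x ^+ d) =
    (\prod_(b <- iota 1 N.-1) F ((z ^+ d) ^+ b)) ^+ d.
Proof.
rewrite /nontriv_roots big_allpairs_dep /=.
under eq_bigr => a _ do under eq_bigr => b _ do rewrite nontriv_roots_exp.
by rewrite big_const_seq count_predT size_iota iter_mulr_1.
Qed.

Lemma nontriv_rootsP (x : algC) : x \in nontriv_roots ->
  exists2 b, (0 < b < N)%N & x ^+ d = (z ^+ d) ^+ b.
Proof.
case/allpairsP=> -[a b] /= [_ b_in ->]; exists b; rewrite ?nontriv_roots_exp //.
by move: b_in; rewrite mem_iota add1n prednK.
Qed.

Lemma prim_exp_neq1 {b : nat} : (0 < b < N)%N -> (z ^+ d) ^+ b != 1.
Proof.
by move=> /andP[b_gt0 lt_bN]; rewrite -(prim_order_dvd prim_exp_d) gtnNdvd.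
Qed.

(** All exponents lie below the order N d of [z], so equal powers have equal exponents, and
    Euclidean division by N recovers a and b. *)
Lemma nontriv_roots_uniq : uniq nontriv_roots.
Proof.
apply: allpairs_uniq; rewrite ?iota_uniq // => -[a b] [a' b'].
move=> /allpairsP[[? ?] /= [a_in b_in [-> ->]]].
move=> /allpairsP[[? ?] /= [a'_in b'_in [-> ->]]] /eqP.
move: a_in b_in a'_in b'_in; rewrite !mem_iota !add0n !add1n !prednK //=.
move=> lt_a /andP[_ lt_b] lt_a' /andP[_ lt_b'].
have lt_ab i j : (i < d)%N -> (j < N)%N -> (N * i + j < N * d)%N.
  move=> lt_i lt_j; apply: leq_trans (_ : (N * i.+1 <= _)%N).
    by rewrite mulnS addnC ltn_add2r.
  by rewrite leq_mul2l lt_i orbT.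
rewrite (eq_prim_root_expr z_prim) !modn_small ?lt_ab // => /eqP eq_ab.
have := congr1 (divn^~ N) eq_ab; have := congr1 (modn^~ N) eq_ab.
rewrite /= ![(N * _)%N]mulnC !modnMDl !divnMDl // !(divn_small, modn_small) //.
by rewrite !addn0 => -> ->.
Qed.

Lemma nontriv_roots_root : all (root (toC (geo N \Po 'X^d))) nontriv_roots.
Proof.
apply/allP=> x /nontriv_rootsP[b b_bd xd]; rewrite /root toC_comp xd.
have := toC_geo N ((z ^+ d) ^+ b).
rewrite [_ ^+ b ^+ N]exprAC (prim_expr_order prim_exp_d).
rewrite expr1n subrr => /eqP; rewrite mulf_eq0 subr_eq0.
by rewrite (negPf (prim_exp_neq1 b_bd)).
Qed.

(** These are all the roots of [geo N] at X^d, a monic polynomial with value N at 1. *)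
Lemma prod_1sub_nontriv_roots : \prod_(x <- nontriv_roots) (1 - x) = N%:R.
Proof.
rewrite (prod_1sub_roots (geo_comp_monic N_gt0 d_gt0)).
- by rewrite toC_comp expr1n toC_geo1.
- exact: nontriv_roots_uniq.
- exact: nontriv_roots_root.
by rewrite size_geo_comp // size_nontriv_roots.
Qed.

End NontrivialPowerRoots.

Arguments prim_exp_d {N d z}.
Arguments prod_nontriv_roots {N d z}.
Arguments nontriv_rootsP {N d z} _ _ {x}.
Arguments prim_exp_neq1 {N d z} _ _ {b}.
Arguments nontriv_roots_uniq {N d z}.
Arguments nontriv_roots_root {N d z}.
Arguments prod_1sub_nontriv_roots {N d z}.

(** * Values of f^{R,S} at roots of unity *)

Lemma prod_1sub_prim {N : nat} {w : algC} : (0 < N)%N ->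
  N.-primitive_root w -> \prod_(b <- iota 1 N.-1) (1 - w ^+ b) = N%:R.
Proof.
(* For d = 1, [nontriv_roots] lists the N-th roots of unity other than 1. *)
rewrite -{2}[N]muln1 => N_gt0 w_prim.
rewrite -(prod_1sub_nontriv_roots N_gt0 (ltn0Sn 0) w_prim).
exact/esym/(prod_nontriv_roots w_prim (fun x => 1 - x)).
Qed.

(** For v = x^R and u = x^S the equation reads (x - 1) f^{R,S}(x) = 0. It gives v u = 2 v - 1, so v
    lies on the circles |v| = 1 and |2 v - 1| = 1, which are tangent at 1. *)
Lemma norm1_frs_eq0 {u v : algC} :
  `|u| = 1 -> `|v| = 1 -> v - 1 - v * (u - 1) = 0 -> v = 1 /\ u = 1.
Proof.
move=> norm_u norm_v uv0.
have v0 : v != 0 by rewrite -normr_eq0 norm_v oner_eq0.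
have uvE : v * u = 2 * v - 1.
  by apply/eqP; rewrite -subr_eq0 -oppr_eq0 -uv0; apply/eqP; ring.
have vv : v * v^* = 1 by rewrite -normCK norm_v expr1n.
have v1 : v = 1.
  apply/eqP; rewrite -subr_eq0 -normr_eq0 -sqrf_eq0 normCK.
  have := normCK (v * u); rewrite normrM norm_u norm_v mulr1 expr1n uvE.
  rewrite !rmorphB !rmorphM !rmorph1 /= conjC_nat => vvE.
  (* This writes |v - 1|^2 in terms of |2 v - 1|^2 - 1 and |v|^2 - 1, both zero. *)
  have -> : (v - 1) * (v^* - 1) =
      2^-1 * ((2 * v - 1) * (2 * v^* - 1) - 1) - (v * v^* - 1) by field.
  by rewrite -vvE vv !subrr mulr0 subrr.
split=> //; move: uvE; rewrite v1 mul1r => ->; ring.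
Qed.

(** A zero x = w^b would satisfy x^R = x^S = 1, so N would divide b R, b S and b N, hence b itself,
    against 0 < b < N. *)
Lemma frs_prim_neq0 {N R S b : nat} {w : algC} :
  (0 < b < N)%N -> gcdn (gcdn R N) S = 1%N -> N.-primitive_root w ->
  (toC (frs R S)).[w ^+ b] != 0.
Proof.
move=> /andP[b_gt0 lt_bN] coRNS w_prim; apply/negP=> /eqP root_wb.
have norm_w m : `|w ^+ m| = 1.
  have N_gt0 : (0 < N)%N by apply: leq_ltn_trans lt_bN.
  rewrite normrX; suff /eqP-> : `|w| == 1 by rewrite expr1n.
  by rewrite -(pexpr_eq1 N_gt0) // -normrX (prim_expr_order w_prim) normr1.
have := congr1 (fun p => (toC p).[w ^+ b]) (Xsub1_frs R S).
rewrite rmorphM /= hornerM root_wb mulr0 => /esym.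
rewrite !(rmorphM, rmorphB, rmorph1) /= !map_polyXn !hornerE -!exprM.
move=> /(norm1_frs_eq0 (norm_w _) (norm_w _)) [/eqP wR /eqP wS].
move: wR wS; rewrite -!(prim_order_dvd w_prim) => dvdR dvdS.
suff : (N %| b)%N by rewrite gtnNdvd.
by rewrite -[b]muln1 -coRNS !muln_gcdr !dvdn_gcd dvdR dvdS dvdn_mull.
Qed.

(** The resultant is, up to sign, the product of f^{R,S} over all N-th roots of unity; the root 1
    contributes R - S. *)
Lemma Res_frs {N R S : nat} {w : algC} : (0 < N)%N -> N.-primitive_root w ->
  (Res (frs R S) ('X^N - 1))%:R = `|R%:R - S%:R| *
    `|\prod_(b <- iota 1 N.-1) (toC (frs R S)).[w ^+ b]| :> algC.
Proof.
rewrite -{2}[N]muln1 => N_gt0 w_prim; rewrite /Res natr_absz intr_norm.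
rewrite (@resultant_roots _ _ (1 :: nontriv_roots N 1 w)).
- rewrite big_cons normrM frs1 //; congr (_ * `|_|).
  exact: (prod_nontriv_roots w_prim (fun x => (toC (frs R S)).[x])).
- by rewrite monicXnsubC.
- rewrite /= (nontriv_roots_uniq N_gt0 w_prim) andbT.
  apply/negP=> /(nontriv_rootsP N_gt0 w_prim)[b b_bd /esym/eqP].
  by apply/negP; rewrite expr1n (prim_exp_neq1 (ltn0Sn 0) w_prim b_bd).
- have rs_root := nontriv_roots_root N_gt0 (ltn0Sn 0) w_prim.
  have := geoM N 1; rewrite muln1 => <-.
  rewrite rmorphM /= rootM; apply/andP; split.
    by rewrite rmorphB rmorph1 /= map_polyXn /root !hornerE subrr eqxx.
  by apply/allP=> x /(allP rs_root); rewrite rootM orbC => ->.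
by rewrite size_XnsubC //= size_nontriv_roots mul1n prednK.
Qed.

(** * The cases s > r and s = r *)

(** The root 1 contributes S - R once to the determinantal divisor but d times to the power of the
    resultant, whence the exponent d - 1. The denominator is cleared to stay in the natural
    numbers. *)
Lemma circulant_frs_lt {N R S d : nat} {e : 'rV[int]_(N * d)} :
    (0 < N)%N -> (0 < d)%N -> (R < S)%N -> gcdn (gcdn R N) S = 1%N ->
    smith_form (circulant (N * d) (frs (R * d) (S * d))) e ->
  int_rank (circulant (N * d) (frs (R * d) (S * d))) = (d * N.-1).+1 /\
  (det_divisor e (d * N.-1).+1 * (S - R) ^ (d - 1) =
     Res (frs R S) ('X^N - 1) ^ d)%N.
Proof.
move=> N_gt0 d_gt0 lt_RS coRNS; rewrite -frs_comp => smithC.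
have n_gt0 : (0 < N * d)%N by rewrite muln_gt0 N_gt0.
have [z z_prim] := C_prim_root_exists n_gt0.
have w_prim := prim_exp_d d_gt0 z_prim.
pose rs := 1 :: nontriv_roots N d z; pose g := toC (frs R S).
pose P := \prod_(b <- iota 1 N.-1) g.[z ^+ d ^+ b].
have monh := geo_comp_monic N_gt0 d_gt0.
have prodE :
    \prod_(x <- rs) (toC (frs R S \Po 'X^d)).[x] = (R%:R - S%:R) * P ^+ d.
  rewrite big_cons toC_comp expr1n frs1 -prod_nontriv_roots //; congr (_ * _).
  by apply: eq_bigr => x _; rewrite toC_comp.
have g1 : `|R%:R - S%:R| = (S - R)%:R :> algC.
  by rewrite distrC -natrB 1?ltnW // normr_nat.
have Dh : geo d * (('X - 1) * (geo N \Po 'X^d)) = 'X^(N * d) - 1.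
  by rewrite mulrA [_ * ('X - 1)]mulrC geoX1 geoM.
have rs_uniq : uniq rs.
  rewrite /= nontriv_roots_uniq // andbT.
  apply/negP=> /(nontriv_rootsP N_gt0 z_prim)[b b_bd /esym/eqP].
  by apply/negP; rewrite expr1n (prim_exp_neq1 d_gt0 z_prim b_bd).
have rs_root : all (root (toC (('X - 1) * (geo N \Po 'X^d)))) rs.
  have rs_root := nontriv_roots_root N_gt0 d_gt0 z_prim.
  rewrite rmorphM /= rootM; apply/andP; split.
    by rewrite rmorphB rmorph1 /= map_polyX /root !hornerE subrr eqxx.
  by apply/allP=> x /(allP rs_root); rewrite rootM orbC => ->.
have P_neq0 : P != 0.
  rewrite prodf_seq_neq0; apply/allP=> b; rewrite mem_iota add1n prednK //.
  by move=> b_bd; apply: frs_prim_neq0 b_bd coRNS w_prim.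
have size_rs : size rs = (d * N.-1).+1 by rewrite /= size_nontriv_roots.
have [|||rkC gammaE] := circulant_invariants n_gt0 (geo_monic d_gt0) _ Dh
  rs_uniq rs_root _ _ smithC.
- by rewrite monicMl ?monicXsubC.
- rewrite size_monicM ?monicXsubC ?monic_neq0 //.
  by rewrite size_XsubC size_geo_comp // size_rs.
- rewrite prodE mulf_neq0 ?expf_neq0 // -normr_eq0 g1 pnatr_eq0 -lt0n.
  by rewrite subn_gt0.
rewrite size_rs prodE in rkC gammaE; split=> //.
apply/eqP; rewrite -(eqr_nat algC) natrM !natrX gammaE (Res_frs N_gt0 w_prim).
rewrite exprMn g1 normrM normrX g1 mulrAC -exprS; apply/eqP.
by rewrite subn1 prednK.
Qed.

Lemma circulant_frs_diag {N R d : nat} {e : 'rV[int]_(N * d)} :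
    (0 < N)%N -> (0 < d)%N -> (0 < R)%N -> coprime R N ->
    smith_form (circulant (N * d) (frs (R * d) (R * d))) e ->
  int_rank (circulant (N * d) (frs (R * d) (R * d))) = (d * N.-1)%N /\
  det_divisor e (d * N.-1) = (N ^ (d - 1))%N.
Proof.
move=> N_gt0 d_gt0 R_gt0 coRN; rewrite -frs_diag_comp => smithC.
have n_gt0 : (0 < N * d)%N by rewrite muln_gt0 N_gt0.
have [z z_prim] := C_prim_root_exists n_gt0.
have w_prim := prim_exp_d d_gt0 z_prim.
have N_neq0 : N%:R != 0 :> algC by rewrite pnatr_eq0 -lt0n.
pose rs := nontriv_roots N d z.
(* Multiply (1 - x) [geo d](x) = 1 - x^d over the roots: the 1 - x give N and the 1 - x^d give
   N^d. *)
have prod_geod : \prod_(x <- rs) (toC (geo d)).[x] = N%:R ^+ (d - 1).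
  apply: (mulfI N_neq0); rewrite -exprS subn1 prednK //.
  rewrite -{1}(prod_1sub_nontriv_roots N_gt0 d_gt0 z_prim) -big_split /=.
  rewrite -(prod_1sub_prim N_gt0 w_prim).
  rewrite -(prod_nontriv_roots z_prim (fun x => 1 - x)).
  apply: eq_bigr => x _; apply: oppr_inj.
  by rewrite -mulNr !opprB toC_geo.
(* With y = x^d, (1 - y) [geo R](y) = 1 - y^R. As R is prime to N, y^R again runs over the
   nontrivial N-th roots of unity, so the products of 1 - y and of 1 - y^R agree. *)
have prod_geoR : \prod_(x <- rs) (toC (geo R \Po 'X^d)).[x] = 1.
  under eq_bigr => x _ do rewrite toC_comp.
  rewrite (prod_nontriv_roots z_prim (fun x => (toC (geo R)).[x])).
  suff -> : \prod_(b <- iota 1 N.-1) (toC (geo R)).[z ^+ d ^+ b] = 1.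
    by rewrite expr1n.
  apply: (mulfI N_neq0); rewrite mulr1.
  rewrite -{1}(prod_1sub_prim N_gt0 w_prim) -big_split /=.
  have wR_prim : N.-primitive_root ((z ^+ d) ^+ R).
    by rewrite prim_root_exp_coprime.
  rewrite -(prod_1sub_prim N_gt0 wR_prim).
  apply: eq_bigr => b _; apply: oppr_inj.
  by rewrite -mulNr !opprB toC_geo exprAC.
have prodE : `|\prod_(x <- rs) (toC (- (geo d * (geo R \Po 'X^d) ^+ 2))).[x]|
    = (N ^ (d - 1))%:R.
  rewrite normr_prod.
  under eq_bigr => x _ do
    rewrite rmorphN rmorphM rmorphXn /= hornerN hornerM horner_exp normrN.
  rewrite -normr_prod big_split prodrXl /= prod_geod prod_geoR expr1n mulr1.
  by rewrite natrX normrX normr_nat.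
have size_rs : size rs = (d * N.-1)%N by rewrite size_nontriv_roots.
have [||rkC gammaE] := circulant_invariants n_gt0 (monicXnsubC 1 d_gt0)
  (geo_comp_monic N_gt0 d_gt0) (geoM N d) (nontriv_roots_uniq N_gt0 z_prim)
  (nontriv_roots_root N_gt0 d_gt0 z_prim) _ _ smithC.
- by rewrite size_geo_comp // size_rs.
- by rewrite -normr_eq0 prodE pnatr_eq0 -lt0n expn_gt0 N_gt0.
rewrite -/rs size_rs prodE in rkC gammaE; split=> //.
by apply/eqP; rewrite -(eqr_nat algC) gammaE.
Qed.

Theorem theorem3p1 (n r s : nat) (hn : (1 <= n)%N) (hr : (1 <= r)%N)
    (hs : (1 <= s)%N) :
  let d := gcdn (gcdn r n) s in
  let R := (r %/ d)%N in
  let N := (n %/ d)%N in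
  let S := (s %/ d)%N in
  let C := circulant n (frs r s) in
  let rho := int_rank C in
  forall e : 'rV[int]_n, smith_form C e ->
  let gamma := det_divisor e rho in
  ((r < s)%N ->
     rho = (n - d + 1)%N /\
     gamma%:R = (Res (frs R S) ('X^N - 1))%:R ^+ d
                / (S%:R - R%:R) ^+ (d - 1) :> rat) /\
  (s = r -> rho = (n - d)%N /\ gamma = (N ^ (d - 1))%N).
Proof.
move=> d R N S C rho e; rewrite {}/rho {}/C.
have d_gt0 : (0 < d)%N by rewrite !gcdn_gt0 hr.
have defr : r = (R * d)%N.
  by rewrite divnK // (dvdn_trans (dvdn_gcdl _ _)) ?dvdn_gcdl.
have defn : n = (N * d)%N.
  by rewrite divnK // (dvdn_trans (dvdn_gcdl _ _)) ?dvdn_gcdr.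
have defs : s = (S * d)%N by rewrite divnK // dvdn_gcdr.
have coRNS : gcdn (gcdn R N) S = 1%N.
  apply/eqP; rewrite -(eqn_pmul2r d_gt0) !muln_gcdl mul1n -defr -defn -defs.
  exact: eqxx.
clearbody d R N S; subst n r s.
move: hn hr; rewrite !muln_gt0 d_gt0 !andbT => N_gt0 R_gt0 smithC.
(* This is the degree of [geo N] at X^d; for s > r the extra factor X - 1 of h adds one to the
   rank. *)
have -> : (N * d - d = d * N.-1)%N by rewrite -subn1 mulnBr muln1 mulnC.
split=> [|eqSR].
  rewrite ltn_pmul2r // => lt_RS.
  have [-> gammaE] := circulant_frs_lt N_gt0 d_gt0 lt_RS coRNS smithC.
  split; first by rewrite addn1.
  rewrite -natrX -gammaE natrM natrX natrB 1?ltnW // mulfK //.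
  by rewrite expf_neq0 // subr_eq0 eqr_nat gtn_eqF.
have {}eqSR : S = R by apply/eqP; rewrite -(eqn_pmul2r d_gt0) eqSR.
subst S; rewrite gcdnC gcdnA gcdnn in coRNS.
have coRN : coprime R N by apply/eqP.
by have [-> ->] := circulant_frs_diag N_gt0 d_gt0 R_gt0 coRN smithC.
Qed.
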